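(* There exists a bounded, separable, two-dimensional $\mathrm{CAT}(0)$ simplicial complex $X$ such that the weak topology $\mathcal T_{\Delta}$ on $X$ is not Hausdorff.
   Context: All $\mathrm{CAT}(0)$ spaces are by definition complete and geodesic. A bounded sequence $(x_n)$ in a $\mathrm{CAT}(0)$ space $X$ converges weakly to a point $x\in X$ if for any compact geodesic $c$ in $X$ starting at $x$, the closest-point projections $\mathrm{Proj}_c(x_n)$ of $x_n$ to $c$ converge to $x$. The weak topology $\mathcal T_{\Delta}$ on $X$ is the topology whose closed sets are exactly those subsets $A\subset X$ such that whenever a bounded sequence of points of $A$ converges weakly to a point $x\in X$, one has $x\in A$. (It is the unique sequential topology on $X$ for which a sequence converges to $x$ if and only if it is bounded and converges weakly to $x$.) *)

(* Defs.v *)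
From HB Require Import structures.
From mathcomp Require Import all_boot all_order all_algebra.
From mathcomp Require Import all_classical all_reals all_analysis.

Set Implicit Arguments.
Unset Strict Implicit.
Unset Printing Implicit Defensive.
Import Order.TTheory GRing.Theory Num.Theory.
Import numFieldNormedType.Exports.
Local Open Scope classical_set_scope.
Local Open Scope ring_scope.

(* The norm carried by ['rV_n] in the library is the sup norm, hence the
   explicit Euclidean distance. *)
Definition eucl_dist (R : realType) (n : nat) (u v : 'rV[R]_n) : R :=
  Num.sqrt (\sum_(i < n) (u 0 i - v 0 i) ^+ 2).

Definition eucl_segment (R : realType) (n : nat) (u v : 'rV[R]_n) : set 'rV[R]_n :=
  [set w | exists t : R, 0 <= t <= 1 /\ w = (1 - t) *: u + t *: v].

Section MetricSpaces.
Variables (R : realType) (X : metricType R).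

Definition mbounded (A : set X) : Prop :=
  exists M : R, forall x y : X, A x -> A y -> mdist x y <= M.

Definition mcomplete : Prop :=
  forall u : nat -> X, cauchy (u @ \oo) -> exists l : X, u @ \oo --> l.

Definition mseparable : Prop :=
  exists D : set X, countable D /\ dense D.

(* [c] is only constrained on the interval [0, d(x, y)]. *)
Definition geodesic (x y : X) (c : R -> X) : Prop :=
  [/\ c 0 = x, c (mdist x y) = y &
      forall s t : R, 0 <= s <= mdist x y -> 0 <= t <= mdist x y ->
        mdist (c s) (c t) = `|s - t|].

Definition geodesic_segment (x y : X) (S : set X) : Prop :=
  exists2 c : R -> X, geodesic x y c & S = c @` `[0, mdist x y].

Definition geodesic_space : Prop :=
  forall x y : X, exists S : set X, geodesic_segment x y S.

(* [p'], on the side [x', y'] of a comparison triangle, is the comparison point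
   of the point [p] of the side [S] joining [x] to [y]. *)
Definition side_comparison (x y : X) (S : set X) (x' y' : 'rV[R]_2)
    (p : X) (p' : 'rV[R]_2) : Prop :=
  [/\ S p, eucl_segment x' y' p' & eucl_dist x' p' = mdist x p].

Definition cat0_inequality : Prop :=
  forall (x y z : X) (Sxy Syz Szx : set X) (x' y' z' : 'rV[R]_2),
    geodesic_segment x y Sxy ->
    geodesic_segment y z Syz ->
    geodesic_segment z x Szx ->
    eucl_dist x' y' = mdist x y ->
    eucl_dist y' z' = mdist y z ->
    eucl_dist z' x' = mdist z x ->
    let comparison p p' :=
      [\/ side_comparison x y Sxy x' y' p p',
          side_comparison y z Syz y' z' p p' |
          side_comparison z x Szx z' x' p p'] in
    forall (p q : X) (p' q' : 'rV[R]_2),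
      comparison p p' -> comparison q q' -> mdist p q <= eucl_dist p' q'.

Definition cat0 : Prop := [/\ mcomplete, geodesic_space & cat0_inequality].

(* Junk value [x] when there is no closest point; in a CAT(0) space the closest
   point of a geodesic segment exists and is unique. *)
Definition metric_proj (C : set X) (x : X) : X :=
  xget x [set y | C y /\ forall z, C z -> mdist x y <= mdist x z].

Definition weakly_cvg (u : nat -> X) (x : X) : Prop :=
  forall (y : X) (S : set X), geodesic_segment x y S ->
    (fun n => metric_proj S (u n)) @ \oo --> x.

Definition weakly_closed (A : set X) : Prop :=
  forall (u : nat -> X) (x : X), (forall n, A (u n)) -> mbounded (range u) ->
    weakly_cvg u x -> A x.

Definition weakly_open (U : set X) : Prop := weakly_closed (~` U).

Definition weak_space : Type := X.

Lemma weakly_cvg_subseq (u : nat -> X) (x : X) (f : nat -> nat) :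
  (forall n, (n <= f n)%N) -> weakly_cvg u x -> weakly_cvg (u \o f) x.
Proof.
move=> fn ux y S xyS; have ufn := ux y S xyS.
apply: (@cvg_comp _ _ _ f (fun n => metric_proj S (u n)) \oo \oo) ufn.
by move=> A [N _ NA]; exists N => // n /= Nn; apply: NA => /=; exact: leq_trans (fn n).
Qed.

Lemma mboundedS (A B : set X) : A `<=` B -> mbounded B -> mbounded A.
Proof. by move=> AB [M BM]; exists M => x y /AB Bx /AB By; exact: BM. Qed.

Lemma weakly_openT : weakly_open setT.
Proof. by move=> u x /(_ 0%N) /(_ I). Qed.

Lemma weakly_openI : setI_closed weakly_open.
Proof.
move=> A B oA oB u x; rewrite setCI => uAB bu ux.
have sub (f : nat -> nat) C : (forall n, (n <= f n)%N) -> weakly_open C ->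
    (forall n, ~ C (u (f n))) -> ~ C x.
  move=> fn oC Cf; apply: (oC (u \o f)) => //; last exact: weakly_cvg_subseq.
  by apply: mboundedS bu => _ [n _ <-]; exists (f n).
have [H|/existsNP[N HN]] :=
    pselect (forall N, exists n, (N <= n)%N /\ ~ A (u n)).
  have [f Hf] := choice H.
  by left; apply: (sub f) => // n; have [] := Hf n.
right; apply: (sub (fun n => n + N)%N) => // [n|n]; first exact: leq_addr.
have [Au|//] := uAB (n + N)%N.
by case: HN; exists (n + N)%N; split=> //; exact: leq_addl.
Qed.

Lemma weakly_open_bigcup (I : Type) (f : I -> set X) :
  (forall i, weakly_open (f i)) -> weakly_open (\bigcup_i f i).
Proof.
move=> of_ u x uf bu ux [i _ fix_]; apply: (of_ i u x) => // n fun_.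
by apply: (uf n); exists i.
Qed.

End MetricSpaces.

HB.instance Definition _ (R : realType) (X : metricType R) :=
  Choice.copy (weak_space X) X.
HB.instance Definition _ (R : realType) (X : metricType R) :=
  isOpenTopological.Build (weak_space X) (@weakly_openT R X) (@weakly_openI R X)
    (@weakly_open_bigcup R X).

Lemma weak_space_closedE (R : realType) (X : metricType R) (A : set X) :
  closed (A : set (weak_space X)) <-> weakly_closed A.
Proof. by rewrite -openC -[X in _ <-> weakly_closed X]setCK. Qed.

Section EuclideanSimplices.
Variables (R : realType) (n : nat).
Implicit Type a : 'I_n.+1 -> 'rV[R]_n.

Definition affinely_independent a : Prop :=
  forall w : 'I_n.+1 -> R, \sum_i w i = 0 -> \sum_i w i *: a i = 0 ->
    forall i, w i = 0.

Definition face a (F : {set 'I_n.+1}) : set 'rV[R]_n :=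
  [set u | exists w : 'I_n.+1 -> R,
    [/\ forall i, 0 <= w i, forall i, i \notin F -> w i = 0,
        \sum_i w i = 1 & u = \sum_i w i *: a i]].

Definition simplex a : set 'rV[R]_n := face a [set: 'I_n.+1].

End EuclideanSimplices.

Definition isometry_onto (R : realType) (m n : nat) (S : set 'rV[R]_m)
    (T : set 'rV[R]_n) (h : 'rV[R]_m -> 'rV[R]_n) : Prop :=
  h @` S = T /\ forall u v, S u -> S v -> eucl_dist (h u) (h v) = eucl_dist u v.

(* Strings from [x] to [y], i.e. finite chains in which any two consecutive
   points lie in a common simplex, together with their length.  The simplex
   [simplex (a s)] is mapped to [X] by [p s]. *)
Inductive string_length (R : realType) (X I : Type) (dim : I -> nat)
    (a : forall s, 'I_(dim s).+1 -> 'rV[R]_(dim s))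
    (p : forall s, 'rV[R]_(dim s) -> X) : X -> X -> R -> Prop :=
| string_nil x : string_length a p x x 0
| string_cons s u v y L :
    simplex (a s) u -> simplex (a s) v -> string_length a p (p s v) y L ->
    string_length a p (p s u) y (eucl_dist u v + L).

(* Simplicial complexes with Euclidean simplices, as in Bridson and Haefliger,
   Chapter I.7 (case kappa = 0), with underlying metric space [X]: the set [X]
   is the quotient of the disjoint union of a (possibly infinite) family of
   Euclidean simplices obtained by isometric gluing along faces, and the
   distance of [X] is the infimum of the lengths of strings.  The family may
   but need not list the proper faces of its members. *)
Record euclidean_simplicial_complex (R : realType) (X : metricType R) := {
  cell : Type ;
  cell_dim : cell -> nat ;
  cell_vertex : forall s, 'I_(cell_dim s).+1 -> 'rV[R]_(cell_dim s) ;
  cell_map : forall s, 'rV[R]_(cell_dim s) -> X ;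
  cell_vertex_indep : forall s, affinely_independent (@cell_vertex s) ;
  cell_map_inj : forall s u v, simplex (@cell_vertex s) u ->
    simplex (@cell_vertex s) v -> cell_map u = cell_map v -> u = v ;
  cell_map_cover : forall x, exists s,
    exists2 u, simplex (@cell_vertex s) u & cell_map u = x ;
  cell_map_glue : forall s t,
    (exists u v, [/\ simplex (@cell_vertex s) u, simplex (@cell_vertex t) v &
                     cell_map u = cell_map v]) ->
    exists F G h,
      isometry_onto (face (@cell_vertex s) F) (face (@cell_vertex t) G) h /\
      forall u v, simplex (@cell_vertex s) u -> simplex (@cell_vertex t) v ->
        (cell_map u = cell_map v <->
         [/\ face (@cell_vertex s) F u, face (@cell_vertex t) G v & h u = v]) ;
  cell_string : forall x y,
    [set L | string_length cell_vertex cell_map x y L] !=set0 ;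
  cell_mdist : forall x y,
    mdist x y = inf [set L | string_length cell_vertex cell_map x y L]
}.

Definition two_dimensional (R : realType) (X : metricType R)
    (K : euclidean_simplicial_complex X) : Prop :=
  (forall s : cell K, (cell_dim s <= 2)%N) /\
  exists s : cell K, cell_dim s = 2%N.

(* Main.v *)
(** In the plane let [y = (0, 0)], [z = (1, 0)], [p = (1, 1)] and [q = (0, 2)], and
cut the trapezoid [y z p q] along the diagonal [y p] into the lower triangle
[y z p] and the upper triangle [y p q].  Glue countably many copies of the lower
triangle along the edge [y z], and along the diagonal of each of them countably
many copies of the upper triangle.  Writing [p_k] and [q_kj] for the copies of
[p] and [q], the right angles at [z] and [p] give [p_k -> z] and [q_kj -> p_k] as
[j -> oo] weakly, while the right angle of the trapezoid at [y] gives
[q_(k_i j_i) -> y] weakly whenever [k_i -> oo], for arbitrary [j_i].  So a weak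
neighbourhood of [y] contains all the [q_kj] with [k] large, a weak neighbourhood
of [z] contains some of them, and [y], [z] cannot be separated.

Any two copies of the trapezoid unfold to a convex polygon, which gives the
squared distance in closed form: it is the Euclidean one plus [4 b b'] for points
at heights [b], [b'] above [y z] lying on different lower sheets, respectively
plus [2 (b - a)^+ (b' - a')^+] for points [(a, b)], [(a', b')] on different upper
sheets of the same lower sheet.  Along a segment of the unfolding the correction
terms are convex, and this yields the inequality of Bruhat and Tits, from which
the triangle inequality, the geodesics and the CAT(0) comparison all follow. *)

Require Import Defs.
From HB Require Import structures.
From mathcomp Require Import all_boot all_order all_algebra.
From mathcomp Require Import all_classical all_reals all_analysis.
From mathcomp Require Import ring lra.

Set Implicit Arguments.
Unset Strict Implicit.
Unset Printing Implicit Defensive.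
Import Order.TTheory GRing.Theory Num.Theory.
Import numFieldNormedType.Exports.
Local Open Scope classical_set_scope.
Local Open Scope ring_scope.

(** * Stewart's inequality and the CAT(0) condition *)

Lemma eucl_distE (R : realType) n (u v : 'rV[R]_n) :
  eucl_dist u v ^+ 2 = \sum_(i < n) (u 0 i - v 0 i) ^+ 2.
Proof. by rewrite sqr_sqrtr// sumr_ge0// => i _; rewrite sqr_ge0. Qed.

Lemma eucl_dist_ge0 (R : realType) n (u v : 'rV[R]_n) : 0 <= eucl_dist u v.
Proof. exact: sqrtr_ge0. Qed.

Lemma eucl_dist_sym (R : realType) n (u v : 'rV[R]_n) :
  eucl_dist u v = eucl_dist v u.
Proof. by congr Num.sqrt; apply: eq_bigr => i _; ring. Qed.

Lemma eucl_dist_Stewart (R : realType) n (p u v : 'rV[R]_n) (t : R) :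
  eucl_dist p ((1 - t) *: u + t *: v) ^+ 2 =
  (1 - t) * eucl_dist p u ^+ 2 + t * eucl_dist p v ^+ 2
  - t * (1 - t) * eucl_dist u v ^+ 2.
Proof.
rewrite !eucl_distE !mulr_sumr -big_split/= -sumrB.
by apply: eq_bigr => i _; rewrite !mxE; ring.
Qed.

Lemma eucl_dist_segment (R : realType) n (u v : 'rV[R]_n) (t : R) :
  0 <= t -> eucl_dist u ((1 - t) *: u + t *: v) = t * eucl_dist u v.
Proof.
move=> t0; apply: (pexpIrn (n := 2)) => //; rewrite ?nnegrE ?eucl_dist_ge0//.
  by rewrite mulr_ge0// eucl_dist_ge0.
rewrite eucl_dist_Stewart exprMn.
suff -> : eucl_dist u u ^+ 2 = 0 by ring.
by rewrite eucl_distE big1// => i _; rewrite subrr expr0n.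
Qed.

Section StewartPoints.
Variables (R : realType) (X : metricType R).
Implicit Types (x y z p w m : X) (t : R).

(* Stewart's identity, as an inequality, characterizes the point dividing [x, y]
   in the ratio [t : 1 - t]; the existence of such points is the CAT(0)
   condition in the form of Bruhat and Tits. *)
Definition stewart t x y m := forall p,
  mdist p m ^+ 2 <=
  (1 - t) * mdist p x ^+ 2 + t * mdist p y ^+ 2 - t * (1 - t) * mdist x y ^+ 2.

(** Testing the inequality at [x] and at [y] bounds the two distances from above; the triangle
    inequality then forces equality in both. *)
Lemma stewart_dist t x y m : 0 <= t <= 1 -> stewart t x y m ->
  mdist x m = t * mdist x y /\ mdist m y = (1 - t) * mdist x y.
Proof.
move=> /andP[t0 t1] xym.
have xm : mdist x m <= t * mdist x y.
  rewrite -ler_sqr ?nnegrE ?mulr_ge0 ?mdist_ge0//.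
  by have := xym x; rewrite mdistxx; lra.
have my : mdist m y <= (1 - t) * mdist x y.
  rewrite -ler_sqr ?nnegrE ?mulr_ge0 ?mdist_ge0 ?subr_ge0//.
  by have := xym y; rewrite mdistxx (metric_sym y m) (metric_sym y x); lra.
by have := metric_triangle x m y; split; lra.
Qed.

(** Tested at [w] itself, the right-hand side of the inequality vanishes. *)
Lemma stewart_unique t x y m w : stewart t x y m ->
  mdist x w = t * mdist x y -> mdist w y = (1 - t) * mdist x y -> w = m.
Proof.
move=> xym xw wy; apply/mdist_positivity/eqP.
rewrite -sqrf_eq0 eq_le sqr_ge0 andbT (le_trans (xym w))//.
by rewrite wy (metric_sym w) xw le_eqVlt; apply/orP; left; apply/eqP; ring.
Qed.

Hypothesis stewart_ex : forall x y t, 0 <= t <= 1 -> exists m, stewart t x y m.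

Lemma stewart_geodesic_space : geodesic_space X.
Proof.
move=> x y; have [xy0|xy0] := eqVneq (mdist x y) 0.
  have <- : x = y by exact: mdist_positivity.
  exists ((fun=> x) @` `[0, mdist x x]), (fun=> x) => //.
  split=> // s t; rewrite mdistxx => s0 t0.
  suff -> : s = t by rewrite subrr normr0.
  by apply/eqP; rewrite eq_le; lra.
have xy_gt0 : 0 < mdist x y by rewrite lt_neqAle eq_sym xy0 mdist_ge0.
(* The points are chosen independently for each [s]. The inequality for [c t], tested at [c s],
   later gives the upper bound [t - s], and the triangle inequality gives the lower one. *)
have /choice[c cP] (s : R) :
    exists m, 0 <= s <= mdist x y -> stewart (s / mdist x y) x y m.
  have [s01|s01] := boolP (0 <= s <= mdist x y); last by exists x.
  have [|m xym] := @stewart_ex x y (s / mdist x y); last by exists m.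
  by rewrite divr_ge0/= ?mdist_ge0 ?ler_pdivrMr ?mul1r//; lra.
have cd s : 0 <= s <= mdist x y ->
    mdist x (c s) = s /\ mdist (c s) y = mdist x y - s.
  move=> s01; have [|-> ->] := stewart_dist _ (cP s s01).
    by rewrite divr_ge0/= ?mdist_ge0 ?ler_pdivrMr ?mul1r//; lra.
  by rewrite mulrBl !mulfVK// mul1r.
exists (c @` `[0, mdist x y]), c => //; split.
- by apply/esym/mdist_positivity; have [|] := cd 0; rewrite // lexx mdist_ge0.
- apply/mdist_positivity; have [|_ ->] := cd (mdist x y); last by rewrite subrr.
  by rewrite mdist_ge0 lexx.
- wlog st : / forall s t, 0 <= s <= mdist x y -> 0 <= t <= mdist x y ->
      s <= t -> mdist (c s) (c t) = `|s - t| => [|s t s01 t01].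
    apply => s t /[dup] s01 /cd[xs sy] /[dup] t01 /cd[xt ty] st.
    rewrite ler0_norm; last by lra.
    have L : mdist (c s) (c t) <= t - s.
      rewrite -ler_sqr ?nnegrE ?mdist_ge0//; last by lra.
      have := cP t t01 (c s); rewrite (metric_sym _ x) xs sy.
      suff -> : (1 - t / mdist x y) * s ^+ 2 +
        t / mdist x y * (mdist x y - s) ^+ 2 -
        t / mdist x y * (1 - t / mdist x y) * mdist x y ^+ 2 = (t - s) ^+ 2 by [].
      by field.
    by have := metric_triangle x (c s) (c t); lra.
  have [?|?] := leP s t; first exact: st.
  by rewrite metric_sym distrC st// ltW.
Qed.

(** Uniqueness carries the inequality over to the points of an arbitrary geodesic. *)
Lemma geodesic_stewart t x y (S : set X) w : geodesic_segment x y S -> S w ->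
  0 <= t <= 1 -> mdist x w = t * mdist x y -> stewart t x y w.
Proof.
move=> [c [c0 c1 cd] ->] [s /= s01 <-] t01.
have {}s01 : 0 <= s <= mdist x y by move: s01; rewrite in_itv.
have xs : mdist x (c s) = s.
  by rewrite -{1}c0 cd ?lexx ?mdist_ge0// sub0r normrN ger0_norm; lra.
have sy : mdist (c s) y = mdist x y - s.
  by rewrite -{1}c1 cd ?lexx ?mdist_ge0// ler0_norm; lra.
rewrite xs => st; have [m xym] := stewart_ex x y t01.
rewrite (stewart_unique (w := c s) xym)// ?xs// sy; lra.
Qed.

Lemma geodesic_ratio x y (S : set X) w : geodesic_segment x y S -> S w ->
  exists2 t, 0 <= t <= 1 & mdist x w = t * mdist x y.
Proof.
move=> [c [c0 c1 cd] ->] [s /= s01 <-].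
have {}s01 : 0 <= s <= mdist x y by move: s01; rewrite in_itv.
have -> : mdist x (c s) = s.
  by rewrite -{1}c0 cd ?lexx ?mdist_ge0// sub0r normrN ger0_norm; lra.
have [xy0|xy0] := eqVneq (mdist x y) 0.
  by exists 0; rewrite ?lexx ?ler01// mul0r; lra.
exists (s / mdist x y); last by rewrite mulfVK.
have xy_gt0 : 0 < mdist x y by rewrite lt_neqAle eq_sym xy0 mdist_ge0.
by rewrite divr_ge0/= ?mdist_ge0 ?ler_pdivrMr ?mul1r//; lra.
Qed.

(** In the plane Stewart's relation is an equality with the same ratio and side length, so
    comparison with the endpoints of a side passes to all its points. *)
Lemma side_comparison_le x y (S : set X) p q
    (x' y' p' q' : 'rV[R]_2) :
  geodesic_segment x y S -> eucl_dist x' y' = mdist x y ->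
  side_comparison x y S x' y' p p' ->
  mdist q x <= eucl_dist q' x' -> mdist q y <= eucl_dist q' y' ->
  mdist q p <= eucl_dist q' p'.
Proof.
move=> xyS xy [Sp [t [t01 ->]] xp] qx qy; have /andP[t0 t1] := t01.
have xyp : stewart t x y p.
  by apply: geodesic_stewart xyS Sp t01 _; rewrite -xp -xy eucl_dist_segment.
rewrite -ler_sqr ?nnegrE ?mdist_ge0 ?eucl_dist_ge0// eucl_dist_Stewart xy.
apply: le_trans (xyp q) _; rewrite lerD2r lerD// ler_wpM2l ?subr_ge0//.
  by rewrite ler_sqr ?nnegrE ?mdist_ge0 ?eucl_dist_ge0.
by rewrite ler_sqr ?nnegrE ?mdist_ge0 ?eucl_dist_ge0.
Qed.

Lemma stewart_cat0_inequality : cat0_inequality X.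
Proof.
move=> x y z Sxy Syz Szx x' y' z' gxy gyz gzx xy yz zx comparison p q p' q' cp cq.
have comparison_le r r' s s' : comparison s s' ->
    mdist r x <= eucl_dist r' x' -> mdist r y <= eucl_dist r' y' ->
    mdist r z <= eucl_dist r' z' -> mdist r s <= eucl_dist r' s'.
  by case=> sc rx ry rz;
    [apply: side_comparison_le gxy xy sc _ _|
     apply: side_comparison_le gyz yz sc _ _|
     apply: side_comparison_le gzx zx sc _ _].
have zz' (w : 'rV[R]_2) : eucl_dist w w = 0.
  have := @eucl_dist_segment R 2 w w 0 (lexx _).
  by rewrite !(mul0r, scale0r, subr0, scale1r, addr0).
(* Two rounds: first [p] is replaced by the three vertices, then [q]. Distances between vertices
   agree with those in the plane. *)
rewrite metric_sym eucl_dist_sym; apply: (comparison_le _ _ _ _ cp);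
  rewrite metric_sym eucl_dist_sym; apply: (comparison_le _ _ _ _ cq);
  by rewrite ?mdistxx ?zz' ?xy ?yz ?zx// metric_sym eucl_dist_sym ?xy ?yz ?zx.
Qed.

(** For large [n] the right angle makes [x] the unique closest point of [S], so the projections are
    eventually constant. *)
Lemma weakly_cvg_right_angle (u : nat -> X) x :
  (forall y (S : set X), geodesic_segment x y S ->
    \forall n \near \oo, forall m, S m ->
      mdist (u n) x ^+ 2 + mdist x m ^+ 2 <= mdist (u n) m ^+ 2) ->
  weakly_cvg u x.
Proof.
move=> ux y S xyS; apply: cvg_near_cst.
move: (ux y S xyS); apply: filterS => n un; rewrite /metric_proj.
have Sx : S x.
  case: xyS => c [c0 _ _] ->; exists 0 => //=.
  by rewrite in_itv/= lexx mdist_ge0.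
case: xgetP => [w _ [Sw /(_ x Sx) uw]|/(_ x)[]]; last first.
  split=> // m /un um; rewrite -ler_sqr ?nnegrE ?mdist_ge0//.
  by apply: le_trans um; rewrite lerDl sqr_ge0.
apply: esym; apply: mdist_positivity; apply/eqP.
rewrite -sqrf_eq0 eq_le sqr_ge0 andbT.
have := un w Sw; rewrite -ler_sqr ?nnegrE ?mdist_ge0// in uw.
by lra.
Qed.

End StewartPoints.

(** * The book of trapezoids *)

Section Book.
Variable R : realType.
Implicit Types (u v p : nat * nat * (R * R)) (a b t : R) (k j : nat).

(* A point [(k, j, (a, b))] is the point [(a, b)] of the [j]-th upper sheet on the
   [k]-th lower sheet; [j] is irrelevant if [b <= a], and [k] if [b = 0]. *)
Definition trapezoid v := [&& 0 <= v.2.1, v.2.1 <= 1, 0 <= v.2.2 & v.2.1 + v.2.2 <= 2].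

Definition overhang v : R := Num.max 0 (v.2.2 - v.2.1).

(** Reflecting one of two points in the fold line between them adds four times the product of their
    distances to that line. Since [overhang] is sqrt 2 times the distance to the diagonal, the
    second factor is 2. *)
Definition crease u v : R :=
  if u.1.1 != v.1.1 then 4 * (u.2.2 * v.2.2) else
  if u.1.2 != v.1.2 then 2 * (overhang u * overhang v) else 0.

Definition sqdist u v : R :=
  (u.2.1 - v.2.1) ^+ 2 + (u.2.2 - v.2.2) ^+ 2 + crease u v.

Lemma overhang_ge0 v : 0 <= overhang v.
Proof. by rewrite /overhang le_max lexx. Qed.

Lemma overhang_ge v : v.2.2 - v.2.1 <= overhang v.
Proof. by rewrite /overhang le_max lexx orbT. Qed.

Lemma overhangE v : v.2.1 <= v.2.2 -> overhang v = v.2.2 - v.2.1.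
Proof. by move=> ?; apply/max_idPr; rewrite subr_ge0. Qed.

Lemma crease_ge0 u v : trapezoid u -> trapezoid v -> 0 <= crease u v.
Proof.
move=> /and4P[_ _ ub _] /and4P[_ _ vb _]; rewrite /crease.
case: ifP => _; first by rewrite !mulr_ge0.
by case: ifP => _ //; rewrite !mulr_ge0// overhang_ge0.
Qed.

Lemma crease_sym u v : crease u v = crease v u.
Proof.
rewrite /crease eq_sym [u.1.2 == _]eq_sym.
by rewrite [u.2.2 * _]mulrC [overhang u * _]mulrC.
Qed.

Lemma sqdist_sym u v : sqdist u v = sqdist v u.
Proof. by rewrite /sqdist crease_sym; ring. Qed.

Lemma sqdist_ge0 u v : trapezoid u -> trapezoid v -> 0 <= sqdist u v.
Proof. by move=> Qu Qv; rewrite !addr_ge0 ?sqr_ge0 ?crease_ge0. Qed.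

(** Stated for representatives, because the triangle inequality is itself deduced from it. *)
Definition stewart_raw t u v m := forall p, trapezoid p ->
  sqdist p m <= (1 - t) * sqdist p u + t * sqdist p v - t * (1 - t) * sqdist u v.

Lemma stewart_raw_sym t u v m :
  stewart_raw (1 - t) v u m -> stewart_raw t u v m.
Proof. by move=> uvm p /uvm; rewrite (sqdist_sym v u); lra. Qed.

(** The Euclidean part satisfies Stewart's identity. The crease with [p] is zero, linear in the
    height, or a nonnegative constant times the convex function [overhang]. *)
Lemma stewart_raw_leaf t k j a b a' b' : 0 <= t <= 1 ->
  stewart_raw t (k, j, (a, b)) (k, j, (a', b'))
    (k, j, ((1 - t) * a + t * a', (1 - t) * b + t * b')).
Proof.
move=> /andP[t0 t1] [[kp jp] [ap bp]] /and4P[/= ap0 _ bp0 _].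
rewrite /sqdist /crease /= !eqxx /=.
case: eqVneq => /= _; last by lra.
case: eqVneq => /= _; first by lra.
set h := overhang (kp, _, _).
suff : h * overhang (k, j, ((1 - t) * a + t * a', (1 - t) * b + t * b')) <=
    h * ((1 - t) * overhang (k, j, (a, b)) + t * overhang (k, j, (a', b'))).
  by lra.
rewrite ler_wpM2l ?overhang_ge0// ge_max /=.
have [h1 h2] := (overhang_ge (k, j, (a, b)), overhang_ge (k, j, (a', b'))).
rewrite addr_ge0 ?mulr_ge0 ?overhang_ge0 ?subr_ge0//=.
by move: h1 h2 => /=; nra.
Qed.

(* For [k != k'] the two trapezoids unfold to the symmetric hexagon
   [0 <= a <= 1, a + `|b| <= 2]. *)
Lemma stewart_raw_page t k j k' j' a b a' b' : 0 <= t <= 1 -> k != k' ->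
  trapezoid (k, j, (a, b)) -> trapezoid (k', j', (a', b')) ->
  0 <= (1 - t) * b - t * b' ->
  stewart_raw t (k, j, (a, b)) (k', j', (a', b'))
    (k, j, ((1 - t) * a + t * a', (1 - t) * b - t * b')).
Proof.
move=> /andP[t0 t1] kk' /and4P[/= a0 _ b0 _] Q' m0.
have /and4P[/= a'0 _ b'0 _] := Q'.
move=> [[kp jp] [ap bp]] Qp; have /and4P[/= ap0 _ bp0 _] := Qp.
have c0 := crease_ge0 Qp Q'.
rewrite /sqdist {4}/crease/= kk' /crease /=.
(* Cases on the page of [p]: on a third page the slack is [4 * t * b' * bp]; on the page [k'] the
   unfolding is exact up to an upper-sheet crease. *)
have [->|kpk] := eqVneq kp k; last first.
  rewrite /=; have [_|_] := eqVneq kp k' => /=; last first.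
    by have := mulr_ge0 t0 (mulr_ge0 b'0 bp0); lra.
  case: eqVneq => /= _; first by lra.
  have := mulr_ge0 t0 (mulr_ge0 (overhang_ge0 (kp, jp, (ap, bp)))
    (overhang_ge0 (k', j', (a', b')))).
  by lra.
rewrite kk' /=; case: eqVneq => /= _; first by lra.
set h := overhang (k, jp, _).
suff : h * overhang (k, j, ((1 - t) * a + t * a', (1 - t) * b - t * b')) <=
    h * ((1 - t) * overhang (k, j, (a, b))) by lra.
rewrite ler_wpM2l ?overhang_ge0// ge_max mulr_ge0 ?overhang_ge0 ?subr_ge0//=.
by have := overhang_ge (k, j, (a, b)); move=> /=; nra.
Qed.

(* For [j != j'] the two upper triangles unfold to the triangle
   [0 <= a, 0 <= b, a + b <= 2]. *)
Lemma stewart_raw_flap t k j j' a b a' b' : 0 <= t <= 1 -> j != j' ->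
  a <= b -> a' <= b' ->
  (1 - t) * a + t * b' <= (1 - t) * b + t * a' ->
  stewart_raw t (k, j, (a, b)) (k, j', (a', b'))
    (k, j, ((1 - t) * a + t * b', (1 - t) * b + t * a')).
Proof.
move=> /andP[t0 t1] jj' ab ab' m0.
move=> [[kp jp] [ap bp]] /and4P[/= ap0 _ bp0 _].
rewrite /sqdist {4}/crease/= eqxx jj' /crease /=.
rewrite (@overhangE (k, j, (a, b)))// (@overhangE (k, j', (a', b')))//.
rewrite (@overhangE (k, j, (_ + _, _)))//=.
(* Reflection in the diagonal swaps [a'] and [b']; the slack is this quantity times a nonnegative
   combination of coordinates and overhangs of [p]. *)
have tab : 0 <= t * (b' - a') by rewrite mulr_ge0// subr_ge0.
have [_|_] := eqVneq kp k => /=; last first.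
  by have := mulr_ge0 tab ap0; have := mulr_ge0 tab bp0; lra.
have := mulr_ge0 tab (overhang_ge0 (kp, jp, (ap, bp))).
have : 0 <= t * (b' - a') * (overhang (kp, jp, (ap, bp)) - (bp - ap)).
  by rewrite mulr_ge0// subr_ge0; exact: overhang_ge (kp, jp, (ap, bp)).
have [->|_] := eqVneq jp j => /=; first by rewrite jj'; lra.
by case: eqVneq => _ /=; lra.
Qed.

(** Irrelevant indices are reset to 0, so that the glued space is a subtype of representatives
    instead of a quotient. *)
Definition normal_form v : nat * nat * (R * R) :=
  (if v.2.2 == 0 then 0%N else v.1.1,
   if v.2.2 <= v.2.1 then 0%N else v.1.2, v.2).

Lemma normal_formK v : normal_form (normal_form v) = normal_form v.
Proof. by rewrite /normal_form /=; case: (_ == 0); case: (_ <= _). Qed.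

Lemma trapezoid_normal_form v : trapezoid (normal_form v) = trapezoid v.
Proof. by []. Qed.

Lemma overhang_eq0 v : v.2.2 <= v.2.1 -> overhang v = 0.
Proof. by move=> ?; apply/max_idPl; rewrite subr_le0. Qed.

Lemma sqdist_normal_form u v : trapezoid u -> trapezoid v ->
  sqdist u (normal_form v) = sqdist u v.
Proof.
case: v => [[k j] [a b]] /and4P[_ _ ub _] /and4P[/= a0 _ b0 _].
rewrite /sqdist; congr (_ + _); rewrite /crease /normal_form /=.
have [->|_] := eqVneq b 0.
  have v0 l i : overhang (l, i, (a, 0)) = 0 by exact: overhang_eq0.
  by rewrite !v0 !mulr0 !if_same.
have [ba|//] := leP b a.
have v0 l i : overhang (l, i, (a, b)) = 0 by exact: overhang_eq0.
by rewrite !v0 !mulr0 !if_same.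
Qed.

Lemma eq_sqdist p u v : trapezoid p -> trapezoid u -> trapezoid v ->
  normal_form u = normal_form v -> sqdist p u = sqdist p v.
Proof.
by move=> Qp Qu Qv uv; rewrite -sqdist_normal_form// uv sqdist_normal_form.
Qed.

(** Once the coordinates agree, the crease is a multiple of the square of the height or a multiple
    of the square of the overhang; it vanishes exactly where [normal_form] forgets the differing
    index. *)
Lemma sqdist0P u v : trapezoid u -> trapezoid v ->
  sqdist u v = 0 <-> normal_form u = normal_form v.
Proof.
move=> Qu Qv; split; last first.
  move=> uv; rewrite (eq_sqdist Qu Qv Qu)//.
  by rewrite /sqdist /crease !subrr !eqxx /=; ring.
case: u v Qu Qv => [[k j] [a b]] [[k' j'] [a' b']] Qu Qv.
have := crease_ge0 Qu Qv; rewrite /sqdist.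
have := sqr_ge0 (a - a'); have := sqr_ge0 (b - b') => /= b2 a2 c0 uv.
have /eqP : (a - a') ^+ 2 = 0 by lra.
have /eqP : (b - b') ^+ 2 = 0 by lra.
rewrite !sqrf_eq0 !subr_eq0 => /eqP bb /eqP aa; subst a' b'.
have : crease (k, j, (a, b)) (k', j', (a, b)) = 0 by lra.
rewrite /crease /normal_form /=.
have [<-|_] := eqVneq k k' => /=; last first.
  case/and4P: Qu => /= a0 _ _ _.
  move/eqP; rewrite mulf_eq0 pnatr_eq0/= mulf_eq0 orbb => /eqP ->.
  by rewrite eqxx a0.
have [<-//|_] := eqVneq j j' => /= /eqP.
rewrite mulf_eq0 pnatr_eq0/= mulf_eq0 => /orP[] /eqP /= m0.
  have := overhang_ge (k, j, (a, b)).
  by rewrite m0 /= subr_le0 => ->.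
have := overhang_ge (k, j', (a, b)).
by rewrite m0 /= subr_le0 => ->.
Qed.

Lemma eq_stewart_raw t u v u' v' m :
  trapezoid u -> trapezoid v -> trapezoid u' -> trapezoid v' ->
  normal_form u = normal_form u' -> normal_form v = normal_form v' ->
  stewart_raw t u v m -> stewart_raw t u' v' m.
Proof.
move=> Qu Qv Qu' Qv' uu vv uvm p Qp; have := uvm p Qp.
rewrite (eq_sqdist Qp Qu Qu')// (eq_sqdist Qp Qv Qv')// (eq_sqdist Qu Qv Qv')//.
by rewrite (sqdist_sym u) (eq_sqdist Qv' Qu Qu')// (sqdist_sym u').
Qed.

Lemma trapezoid_convex t k j k' j' l i a b a' b' : 0 <= t <= 1 ->
  trapezoid (k, j, (a, b)) -> trapezoid (k', j', (a', b')) ->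
  trapezoid (l, i, ((1 - t) * a + t * a', (1 - t) * b + t * b')).
Proof.
move=> /andP[t0 t1] /and4P[/= ? ? ? ?] /and4P[/= ? ? ? ?].
by apply/and4P; split => /=; nra.
Qed.

(** The index clauses record that no sheet other than those of the endpoints is visited. *)
Lemma stewart_raw_ex t u v : 0 <= t <= 1 -> trapezoid u -> trapezoid v ->
  exists m, [/\ trapezoid m, stewart_raw t u v m,
    m.1.1 \in [:: u.1.1; v.1.1] & m.1.2 \in [:: u.1.2; v.1.2]].
Proof.
move: u v => [[k j] [a b]] [[k' j'] [a' b']] t01 Qu Qv.
have t01' : 0 <= 1 - t <= 1 by lra.
have [/andP[t0 t1] /and4P[/= a0 a1 b0 ab] /and4P[/= a0' a1' b0' ab']] :=
  And3 t01 Qu Qv.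
have [kk'|kk'] := eqVneq k k'; last first.
  have [m0|/ltW m0] := leP 0 ((1 - t) * b - t * b').
    exists (k, j, ((1 - t) * a + t * a', (1 - t) * b - t * b')).
    rewrite !inE /= !eqxx ?orbT; split=> //; last exact: stewart_raw_page.
    by apply/and4P; split => //=; nra.
  (* The dividing point lies beyond the edge, on the other page: exchange the endpoints and replace
     [t] by [1 - t]. *)
  exists (k', j', ((1 - (1 - t)) * a' + (1 - t) * a,
    (1 - (1 - t)) * b' - (1 - t) * b)).
  rewrite !inE /= !eqxx ?orbT; split=> //.
    by apply/and4P; split => //=; nra.
  apply: stewart_raw_sym; apply: stewart_raw_page => //; first by rewrite eq_sym.
  by lra.
subst k'.
have [jj'|jj'] := eqVneq j j'.
  subst j'; exists (k, j, ((1 - t) * a + t * a', (1 - t) * b + t * b')).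
  rewrite !inE /= !eqxx ?orbT; split=> //; last exact: stewart_raw_leaf.
  exact: trapezoid_convex Qu Qv.
(* An endpoint on or below the diagonal can be relabelled with the sheet of the other one. *)
have [uab|/ltW uab] := leP b a.
  exists (k, j', ((1 - t) * a + t * a', (1 - t) * b + t * b')).
  rewrite !inE /= !eqxx ?orbT; split=> //; first exact: trapezoid_convex Qu Qv.
  apply: (@eq_stewart_raw t (k, j', (a, b)) (k, j', (a', b'))) => //.
    by rewrite /normal_form /= uab.
  exact: stewart_raw_leaf.
have [vab|/ltW vab] := leP b' a'.
  exists (k, j, ((1 - t) * a + t * a', (1 - t) * b + t * b')).
  rewrite !inE /= !eqxx ?orbT; split=> //; first exact: trapezoid_convex Qu Qv.
  apply: (@eq_stewart_raw t (k, j, (a, b)) (k, j, (a', b'))) => //.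
    by rewrite /normal_form /= vab.
  exact: stewart_raw_leaf.
have [m0|/ltW m0] := leP ((1 - t) * a + t * b') ((1 - t) * b + t * a').
  exists (k, j, ((1 - t) * a + t * b', (1 - t) * b + t * a')).
  rewrite !inE /= !eqxx ?orbT; split=> //; last exact: stewart_raw_flap.
  by apply/and4P; split => //=; nra.
exists (k, j', ((1 - (1 - t)) * a' + (1 - t) * b,
  (1 - (1 - t)) * b' + (1 - t) * a)).
rewrite !inE /= !eqxx ?orbT; split=> //.
  by apply/and4P; split => //=; nra.
apply: stewart_raw_sym; apply: stewart_raw_flap => //; first by rewrite eq_sym.
by lra.
Qed.

(** * The metric on the book *)

Definition rawdist u v : R := Num.sqrt (sqdist u v).

Lemma rawdist_sqr u v : trapezoid u -> trapezoid v ->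
  rawdist u v ^+ 2 = sqdist u v.
Proof. by move=> Qu Qv; rewrite sqr_sqrtr// sqdist_ge0. Qed.

Lemma rawdist0P u v : trapezoid u -> trapezoid v ->
  rawdist u v = 0 <-> normal_form u = normal_form v.
Proof.
move=> Qu Qv; rewrite -sqdist0P//; split=> [uv|uv]; last first.
  by rewrite /rawdist uv sqrtr0.
by rewrite -rawdist_sqr// uv expr0n.
Qed.

(** Divide [u], [w] in the ratio of the two lengths and test Stewart's inequality at [v]: its right
    side is nonnegative and is a positive multiple of [(x + y) ^+ 2 - sqdist u w]. *)
Lemma rawdist_triangle v u w : trapezoid u -> trapezoid v -> trapezoid w ->
  rawdist u w <= rawdist u v + rawdist v w.
Proof.
move=> Qu Qv Qw; have [uv|uv] := eqVneq (rawdist u v) 0.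
  rewrite uv add0r /rawdist [sqdist u w]sqdist_sym [sqdist v w]sqdist_sym.
  by rewrite (eq_sqdist Qw Qu Qv)//; apply/rawdist0P.
have [vw|vw] := eqVneq (rawdist v w) 0.
  rewrite vw addr0 /rawdist (eq_sqdist Qu Qw Qv)//.
  by apply/esym/rawdist0P.
have := stewart_raw_ex _ Qu Qw.
have : 0 < rawdist u v by rewrite lt_neqAle eq_sym uv sqrtr_ge0.
have : 0 < rawdist v w by rewrite lt_neqAle eq_sym vw sqrtr_ge0.
move: (rawdist_sqr Qu Qv) (rawdist_sqr Qv Qw).
set x := rawdist u v; set y := rawdist v w => x2 y2 y0 x0 ex.
have xy0 : 0 < x + y by lra.
have t01 : 0 <= x / (x + y) <= 1.
  by rewrite divr_ge0 ?ler_pdivrMr ?mul1r//; lra.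
have [m [Qm /(_ v Qv) uwm _ _]] := ex _ t01.
rewrite -ler_sqr ?nnegrE ?sqrtr_ge0//; last by lra.
rewrite rawdist_sqr//.
have := le_trans (sqdist_ge0 Qv Qm) uwm.
rewrite (sqdist_sym v) -x2 -y2.
have -> : (1 - x / (x + y)) * x ^+ 2 + x / (x + y) * y ^+ 2 -
  x / (x + y) * (1 - x / (x + y)) * sqdist u w =
  (x * y / (x + y) ^+ 2) * ((x + y) ^+ 2 - sqdist u w).
  by field; lra.
by rewrite pmulr_rge0 ?subr_ge0// divr_gt0 ?mulr_gt0 ?exprn_gt0.
Qed.

Definition book : Type := {v | trapezoid v && (normal_form v == v)}.

HB.instance Definition _ := Choice.on book.

Lemma book_trapezoid (x : book) : trapezoid (val x).
Proof. by case/andP: (valP x). Qed.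

Lemma book_normal_form (x : book) : normal_form (val x) = val x.
Proof. by case/andP: (valP x) => _ /eqP. Qed.

Let bookdist (x y : book) := rawdist (val x) (val y).

Let bookdistxx x : bookdist x x = 0.
Proof. exact/rawdist0P/erefl/book_trapezoid/book_trapezoid. Qed.

Let bookdist_eq0 x y : bookdist x y = 0 -> x = y.
Proof.
move/rawdist0P => /(_ (book_trapezoid x) (book_trapezoid y)).
by rewrite !book_normal_form => /val_inj.
Qed.

Let bookdist_sym x y : bookdist x y = bookdist y x.
Proof. by rewrite /bookdist /rawdist sqdist_sym. Qed.

Let bookdist_triangle y x z : bookdist x z <= bookdist x y + bookdist y z.
Proof. by apply: rawdist_triangle; exact: book_trapezoid. Qed.

HB.instance Definition _ := @isMetric.Build R book bookdist
  bookdistxx bookdist_eq0 bookdist_sym bookdist_triangle.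

Lemma book_mdist_sqr (x y : book) : mdist x y ^+ 2 = sqdist (val x) (val y).
Proof. by rewrite rawdist_sqr ?book_trapezoid. Qed.

End Book.

(** * Geodesics, boundedness, separability and completeness of the book *)

Lemma cauchy_mdist (R : realType) (X : metricType R) (u : nat -> X) :
  cauchy (u @ \oo) -> forall e, 0 < e ->
  exists N, forall m n, (N <= m)%N -> (N <= n)%N -> mdist (u m) (u n) < e.
Proof.
move=> /cauchy_ballP cu e /cu[[/= A B] [[N1 _ NA] [N2 _ NB]] AB].
exists (maxn N1 N2) => m n; rewrite !geq_max => /andP[N1m _] /andP[_ N2n].
by have := AB (u m, u n) (conj (NA _ N1m) (NB _ N2n)); rewrite /= ballEmdist.
Qed.

Lemma cauchy_real_cvg (R : realType) (u : nat -> R) :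
  (forall e, 0 < e -> exists N, forall m n, (N <= m)%N -> (N <= n)%N ->
    `|u m - u n| < e) -> exists l : R, u @ \oo --> l.
Proof.
move=> cu; apply/cvg_ex/cauchy_cvgP/cauchy_ballP => e /cu[N Nu].
exists (u @` [set n | (N <= n)%N], u @` [set n | (N <= n)%N]) => /=.
  by split; exists N => // n /= Nn; exists n.
by move=> [_ _] /= [[m Nm <-] [n Nn <-]]; exact: Nu.
Qed.

Section BookSpace.
Variable R : realType.
Implicit Types (u v w p : nat * nat * (R * R)) (a b t : R) (k j : nat).
Implicit Types (x y z m : book R).

Lemma book_origin_subproof (v := (0%N, 0%N, (0, 0)) : nat * nat * (R * R)) :
  trapezoid v && (normal_form v == v).
Proof.
apply/andP; split; last by rewrite /normal_form /= !if_same.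
by apply/and4P; split => //=; lra.
Qed.

Definition book_origin : book R :=
  exist (fun v => trapezoid v && (normal_form v == v)) _ book_origin_subproof.

Definition book_point v : book R := insubd book_origin (normal_form v).

Lemma val_book_point v : trapezoid v -> val (book_point v) = normal_form v.
Proof.
by move=> Qv; rewrite val_insubd trapezoid_normal_form Qv normal_formK eqxx.
Qed.

Lemma book_pointK x : book_point (val x) = x.
Proof.
by apply: val_inj; rewrite val_book_point ?book_trapezoid ?book_normal_form.
Qed.

Lemma mdist_book_point x v : trapezoid v ->
  mdist x (book_point v) ^+ 2 = sqdist (val x) v.
Proof.
move=> Qv.
by rewrite book_mdist_sqr val_book_point// sqdist_normal_form// book_trapezoid.
Qed.

Lemma stewart_book_point t u v w : trapezoid u -> trapezoid v -> trapezoid w ->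
  stewart_raw t u v w -> stewart t (book_point u) (book_point v) (book_point w).
Proof.
move=> Qu Qv Qw uvw p; rewrite !mdist_book_point// val_book_point//.
rewrite [sqdist (normal_form u) _]sqdist_sym sqdist_normal_form//.
by rewrite (sqdist_sym v); exact/uvw/book_trapezoid.
Qed.

Lemma book_stewart t x y : 0 <= t <= 1 -> exists m, [/\ stewart t x y m,
  (val m).1.1 \in [:: 0%N; (val x).1.1; (val y).1.1] &
  (val m).1.2 \in [:: 0%N; (val x).1.2; (val y).1.2]].
Proof.
move=> t01.
have [v [Qv sv kv jv]] := stewart_raw_ex t01 (book_trapezoid x) (book_trapezoid y).
exists (book_point v); rewrite val_book_point//=.
split; first by rewrite -{1}(book_pointK x) -{1}(book_pointK y);
    apply: stewart_book_point => //; exact: book_trapezoid.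
  by rewrite inE; case: ifP => // _; rewrite kv orbT.
by rewrite inE; case: ifP => // _; rewrite jv orbT.
Qed.

Lemma book_stewart_ex x y t : 0 <= t <= 1 -> exists m, stewart t x y m.
Proof. by move=> /(@book_stewart t x y)[m []]; exists m. Qed.

(** A geodesic is thus confined to finitely many sheets, so points on sheets of large index are
    separated from it by a crease. The index 0 comes from [normal_form]. *)
Lemma book_geodesic x y (S : set (book R)) m : geodesic_segment x y S -> S m ->
  (val m).1.1 \in [:: 0%N; (val x).1.1; (val y).1.1] /\
  (val m).1.2 \in [:: 0%N; (val x).1.2; (val y).1.2].
Proof.
move=> xyS Sm; have [t t01 xm] := geodesic_ratio xyS Sm.
have [w [xyw wk wj]] := book_stewart x y t01.
have [_ my] := stewart_dist t01 (geodesic_stewart book_stewart_ex xyS Sm t01 xm).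
by rewrite (stewart_unique xyw xm my).
Qed.

Lemma book_bounded : mbounded (@setT (book R)).
Proof.
(* The squared distance is at most 1 + 4 + 16 = 21. *)
exists 5 => x y _ _.
rewrite -ler_sqr ?nnegrE ?mdist_ge0// ?ler0n// book_mdist_sqr.
have := book_trapezoid x; have := book_trapezoid y.
case: (val x) (val y) => [[k j] [a b]] [[k' j'] [a' b']].
move=> /and4P[/= ? ? ? ?] /and4P[/= ? ? ? ?]; rewrite /sqdist/=.
have : (a - a') ^+ 2 <= 1 by nra.
have : (b - b') ^+ 2 <= 4 by nra.
have : b * b' <= 2 * 2 by rewrite ler_pM//; lra.
have : overhang (k, j, (a, b)) * overhang (k', j', (a', b')) <= 2 * 2.
  by rewrite ler_pM ?overhang_ge0// ge_max /=; lra.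
rewrite /crease /=; case: ifP => _; first by lra.
by case: ifP => _; lra.
Qed.

(** Approximating from below keeps the rational points inside the trapezoid. *)
Lemma rat_approx_below (c e : R) : 0 <= c -> 0 < e ->
  exists q : rat, [/\ 0 <= ratr q :> R, ratr q <= c & c - ratr q < e].
Proof.
rewrite le_eqVlt => /orP[/eqP <-|c0] e0.
  by exists 0; rewrite rmorph0 subr0 lexx.
have : Num.max 0 (c - e) < c by rewrite gt_max c0/=; lra.
move=> /rat_in_itvoo[q]; rewrite in_itv /= gt_max => /andP[/andP[q0 qe] qc].
by exists q; split; lra.
Qed.

Lemma book_separable : mseparable (book R).
Proof.
exists (range (fun i : nat * nat * (rat * rat) =>
  book_point (i.1.1, i.1.2, (ratr i.2.1, ratr i.2.2)))); split.
  by apply: sub_countable (card_image_le _ _) _; exact: countableP.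
move=> O [x Ox] Oopen.
have /nbhs_ballP[e /= e0 eO] : nbhs x O by exact: open_nbhs_nbhs.
have Qx := book_trapezoid x; move: Qx eO.
rewrite -{2}(book_pointK x); case: (val x) => [[k j] [a b]] Qx eO.
have /and4P[/= a0 a1 b0 ab] := Qx.
have e20 : 0 < e / 2 by lra.
have [q [q0 qa qe]] := rat_approx_below a0 e20.
have [r [r0 rb re]] := rat_approx_below b0 e20.
have Qqr : trapezoid (k, j, (ratr q, ratr r) : R * R).
  by apply/and4P; split => //=; lra.
exists (book_point (k, j, (ratr q, ratr r))); split; last first.
  by exists (k, j, (q, r)).
apply: eO; rewrite ballEmdist /=.
rewrite -ltr_sqr ?nnegrE ?mdist_ge0// ?(ltW e0)// mdist_book_point//.
rewrite val_book_point// sqdist_sym sqdist_normal_form// /sqdist /crease /= !eqxx /=.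
by nra.
Qed.

Lemma book_complete : mcomplete (book R).
Proof.
move=> u /cauchy_mdist cu.
pose a n := (val (u n)).2.1; pose b n := (val (u n)).2.2.
have Q n : [/\ 0 <= a n, a n <= 1, 0 <= b n & a n + b n <= 2].
  by have /and4P := book_trapezoid (u n).
have ab_dist (m n : nat) : `|a m - a n| <= mdist (u m) (u n) /\
    `|b m - b n| <= mdist (u m) (u n).
  have c0 := crease_ge0 (book_trapezoid (u m)) (book_trapezoid (u n)).
  have := sqr_ge0 (a m - a n); have := sqr_ge0 (b m - b n).
  by split; rewrite -ler_sqr ?nnegrE ?mdist_ge0 ?normr_ge0// real_normK ?num_real//
    book_mdist_sqr /sqdist -/(a m) -/(a n) -/(b m) -/(b n); lra.
have [la ala] : exists l : R, a @ \oo --> l.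
  apply: cauchy_real_cvg => e /cu[N Nu]; exists N => m n Nm Nn.
  exact: le_lt_trans (ab_dist m n).1 (Nu _ _ Nm Nn).
have [lb blb] : exists l : R, b @ \oo --> l.
  apply: cauchy_real_cvg => e /cu[N Nu]; exists N => m n Nm Nn.
  exact: le_lt_trans (ab_dist m n).2 (Nu _ _ Nm Nn).
have lim (e : R) : 0 < e -> exists N, forall n, (N <= n)%N ->
    `|la - a n| < e /\ `|lb - b n| < e.
  move=> e0; have /cvgrPdist_lt/(_ e e0)[N1 _ N1a] := ala.
  have /cvgrPdist_lt/(_ e e0)[N2 _ N2b] := blb.
  exists (maxn N1 N2) => n; rewrite geq_max => /andP[/N1a ? /N2b ?].
  by split.
have Ql k j : trapezoid (k, j, (la, lb)).
  have small (c : R) : (forall e, 0 < e -> c < e) -> c <= 0.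
    by move=> ce; rewrite leNgt; apply/negP => /[dup] /ce; rewrite ltxx.
  apply/and4P; split => /=; rewrite -subr_le0; apply: small => e e0;
    have e20 : 0 < e / 2 by [lra|]; have [N /(_ N (leqnn N))] := lim _ e20;
    have [? ? ? ?] := Q N; rewrite !ltr_norml; lra.
(* The coordinates converge; it remains to find a sheet for the limit. Creases are bounded by
   squared distances, so a Cauchy sequence cannot keep crossing one far from its fold line. *)
have [k [j [N Nkj]]] : exists k j N, forall n, (N <= n)%N ->
    crease (val (u n)) (k, j, (la, lb)) = 0.
  have crease_lt (m n : nat) e : 0 < e -> mdist (u m) (u n) < e ->
      crease (val (u m)) (val (u n)) < e ^+ 2.
    move=> e0; rewrite -ltr_sqr ?nnegrE ?mdist_ge0// ?(ltW e0)//.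
    rewrite book_mdist_sqr; apply: le_lt_trans.
    by rewrite lerDr addr_ge0 ?sqr_ge0.
  have /and4P[/= la0 _ lb0 _] := Ql 0%N 0%N.
  have [lb_gt0|lb_le0] := ltP 0 lb; last first.
    have {lb_le0}lb0' : lb = 0 by lra.
    exists 0%N, 0%N, 0%N => n _; rewrite /crease /= lb0' !mulr0.
    by rewrite [overhang (0%N, _, _)]overhang_eq0// !mulr0 !if_same.
  have [k [N1 pk]] : exists k N, forall n, (N <= n)%N -> (val (u n)).1.1 = k.
    (* Heights are eventually at least [lb / 2], so a change of page would cost a crease of at least
       [lb ^+ 2]. *)
    have lb20 : 0 < lb / 2 by lra.
    have [N1 N1b] := lim _ lb20; have [N2 N2u] := cu _ lb_gt0.
    exists (val (u (maxn N1 N2))).1.1, (maxn N1 N2) => n nN.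
    apply/eqP/negPn/negP => kk; move: nN; rewrite geq_max => /andP[nN1 nN2].
    have := crease_lt _ _ _ lb_gt0 (N2u _ _ nN2 (leq_maxr N1 N2)).
    rewrite /crease kk -!/(b _) ltNge => /negP[].
    have [_ bn] := N1b _ nN1; have [_ bN] := N1b _ (leq_maxl N1 N2).
    have hn : lb / 2 <= b n by move: bn; rewrite ltr_norml; lra.
    have hN : lb / 2 <= b (maxn N1 N2) by move: bN; rewrite ltr_norml; lra.
    by have := ler_pM (ltW lb20) (ltW lb20) hn hN; lra.
  exists k; have [lba|lba] := leP lb la.
    exists 0%N, N1 => n /pk kn; rewrite /crease /= kn eqxx /=.
    by rewrite [overhang (k, _, _)]overhang_eq0// !mulr0 if_same.
  (* Overhangs are eventually at least [c / 2], so a change of sheet costs at least [c ^+ 2 / 2],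
     more than the allowed [(c / 2) ^+ 2]. *)
  pose c := lb - la; have c0 : 0 < c by rewrite subr_gt0.
  have [c20 c40] : 0 < c / 2 /\ 0 < c / 4 by lra.
  have [N2 N2b] := lim _ c40; have [N3 N3u] := cu _ c20.
  pose M := maxn N1 (maxn N2 N3).
  exists (val (u M)).1.2, M => n.
  rewrite !geq_max => /and3P[nN1 nN2 nN3].
  have [MN1 MN2 MN3] : [/\ (N1 <= M)%N, (N2 <= M)%N & (N3 <= M)%N].
    by rewrite !leq_max !leqnn !orbT.
  rewrite /crease /= (pk n nN1) eqxx /=; case: eqP => //= /eqP jj.
  have := crease_lt _ _ _ c20 (N3u _ _ nN3 MN3).
  rewrite /crease !pk// eqxx jj /= ltNge => /negP[].
  have oh (m : nat) : (N2 <= m)%N -> c / 2 <= overhang (val (u m)).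
    move=> /N2b[]; have := overhang_ge (val (u m)).
    by rewrite -/(a m) -/(b m) !ltr_norml /c; lra.
  by have := ler_pM (ltW c20) (ltW c20) (oh _ nN2) (oh _ MN2);
    have := sqr_ge0 c; lra.
exists (book_point (k, j, (la, lb))); apply/metricType_numDomainType.cvgrPdist_lt.
move=> e e0; have e20 : 0 < e / 2 by lra.
have [M Mab] := lim _ e20; exists (maxn N M) => // n /=.
rewrite geq_max metric_sym => /andP[/Nkj c0 /Mab[an bn]].
rewrite -ltr_sqr ?nnegrE ?mdist_ge0// ?(ltW e0)// mdist_book_point//.
rewrite /sqdist c0 -/(a n) -/(b n) /=.
by move: an bn; rewrite !ltr_norml; nra.
Qed.
End BookSpace.

(** * Weak convergence *)

(** Otherwise a subsequence would stay in the weakly closed complement of [U] and still converge to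
    [x]. *)
Lemma weakly_open_near (R : realType) (X : metricType R) (U : set X)
    (u : nat -> X) (x : X) :
  weakly_open U -> U x -> mbounded (range u) -> weakly_cvg u x ->
  exists N, forall n, (N <= n)%N -> U (u n).
Proof.
move=> oU Ux bu ux; apply: contrapT => noN.
have /choice[f fP] (n : nat) : exists m, (n <= m)%N /\ ~ U (u m).
  apply: contrapT => nom; apply: noN; exists n => m nm.
  by apply: contrapT => Um; apply: nom; exists m.
apply: (oU (u \o f) x) => //.
- by move=> n; have [] := fP n.
- by apply: mboundedS bu => _ [n _ <-]; exists (f n).
- by apply: weakly_cvg_subseq ux => n; have [] := fP n.
Qed.

Section WeakBook.
Variable R : realType.
Implicit Types (x y m : book R) (k j : nat).

Let trapezoid_z : trapezoid (0%N, 0%N, (1, 0) : R * R).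
Proof. by apply/and4P; split => //=; lra. Qed.

Let trapezoid_y : trapezoid (0%N, 0%N, (0, 0) : R * R).
Proof. by apply/and4P; split => //=; lra. Qed.

Let trapezoid_p k : trapezoid (k, 0%N, (1, 1) : R * R).
Proof. by apply/and4P; split => //=; lra. Qed.

Let trapezoid_q k j : trapezoid (k, j, (0, 2) : R * R).
Proof. by apply/and4P; split => //=; lra. Qed.

Let z : book R := book_point (0%N, 0%N, (1, 0)).
Let y0 : book R := book_point (0%N, 0%N, (0, 0)).
Let p k : book R := book_point (k, 0%N, (1, 1)).
Let q k j : book R := book_point (k, j, (0, 2)).

Let val_z : val z = (0%N, 0%N, (1, 0)).
Proof. by rewrite val_book_point// /normal_form /= !if_same. Qed.

Let val_y : val y0 = (0%N, 0%N, (0, 0)).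
Proof. by rewrite val_book_point// /normal_form /= !if_same. Qed.

Let val_p k : val (p k) = (k, 0%N, (1, 1)).
Proof. by rewrite val_book_point// /normal_form /= oner_eq0 lexx. Qed.

Let val_q k j : val (q k j) = (k, j, (0, 2)).
Proof. by rewrite val_book_point// /normal_form /= pnatr_eq0/= leNgt ltr0n. Qed.

Let weakly_cvg_p : weakly_cvg p z.
Proof.
(* The successor makes [n] differ from 0 and from the page of [y], the only pages met by the
   segment. *)
apply: weakly_cvg_right_angle => y S zyS; exists (val y).1.1.+1 => // n /= yn m Sm.
have [mk _] := book_geodesic zyS Sm.
have := book_trapezoid m; rewrite !book_mdist_sqr val_p val_z.
move: mk; rewrite val_z; case: (val m) => [[k j] [a b]] /=.
rewrite !inE orbA orbb => kE /and4P[/= ? ? ? ?].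
have nk : n != k.
  by apply: contraTneq yn => ->; case/orP: kE => /eqP ->; rewrite ?ltnn.
by rewrite /sqdist /crease /= nk overhang_eq0//= !(mulr0, mul0r, if_same); lra.
Qed.

Let weakly_cvg_q k : weakly_cvg (q k) (p k).
Proof.
apply: weakly_cvg_right_angle => y S pyS; exists (val y).1.2.+1 => // n /= yn m Sm.
have [_ mj] := book_geodesic pyS Sm.
have := book_trapezoid m; rewrite !book_mdist_sqr val_p val_q.
move: mj; rewrite val_p; case: (val m) => [[l j] [a b]] /=.
rewrite !inE orbA orbb => jE /and4P[/= ? ? ? ?].
have nj : n != j.
  by apply: contraTneq yn => ->; case/orP: jE => /eqP ->; rewrite ?ltnn.
rewrite /sqdist /crease /= nj eqxx /=.
rewrite !(@overhang_eq0 _ (k, 0%N, (1, 1)))//= !(mulr0, mul0r, if_same).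
rewrite (@overhangE _ (k, n, (0, 2)))//=.
case: eqVneq => _ /=; last by lra.
have := overhang_ge (l, j, (a, b)); have := overhang_ge0 (l, j, (a, b)).
by move=> /=; lra.
Qed.

(** The page alone provides the crease, so the sheets [g n] may be arbitrary; this makes the bound
    [L] below uniform in [j]. *)
Let weakly_cvg_y (f g : nat -> nat) : (forall n, (n <= f n)%N) ->
  weakly_cvg (fun n => q (f n) (g n)) y0.
Proof.
move=> nf; apply: weakly_cvg_right_angle => y S yyS.
exists (val y).1.1.+1 => // n /= yn m Sm.
have [mk _] := book_geodesic yyS Sm.
have := book_trapezoid m; rewrite !book_mdist_sqr val_q val_y.
move: mk; rewrite val_y; case: (val m) => [[k j] [a b]] /=.
rewrite !inE orbA orbb => kE /and4P[/= ? ? ? ?].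
have nk : f n != k.
  apply: contraTneq (leq_trans yn (nf n)) => ->.
  by case/orP: kE => /eqP ->; rewrite ?ltnn.
rewrite /sqdist /crease /= nk.
rewrite !(@overhang_eq0 _ (0%N, 0%N, (0, 0)))//= !(mulr0, mul0r, if_same).
by lra.
Qed.

Lemma book_weak_not_hausdorff : ~ hausdorff_space (weak_space (book R)).
Proof.
move=> H; have := H z y0.
suff zy : cluster (nbhs (z : weak_space (book R))) y0.
  move=> /(_ zy) /(congr1 val); rewrite val_z val_y => -[/eqP].
  by rewrite oner_eq0.
rewrite clusterEonbhs => A V; rewrite nbhsE => -[U [oU Uz] UA] [oV Vy].
have bdd (u : nat -> book R) : mbounded (range u).
  by apply: mboundedS (@book_bounded R).
have [K Kp] := weakly_open_near oU Uz (bdd _) weakly_cvg_p.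
have [L LV] : exists L, forall k j, (L <= k)%N -> V (q k j).
  apply: contrapT => noL.
  have /choice[h hP] (n : nat) : exists i, (n <= i.1)%N /\ ~ V (q i.1 i.2).
    apply: contrapT => noi; apply: noL; exists n => k j nk.
    by apply: contrapT => Vkj; apply: noi; exists (k, j).
  apply: (oV (fun n => q (h n).1 (h n).2) y0) => //.
    by move=> n; have [] := hP n.
  by apply: weakly_cvg_y => n; have [] := hP n.
(* On the page [maxn K L] the point [p] lies in [U], which is therefore also a weak neighbourhood of
   [p] and contains some [q]; that [q] lies in [V] as well. *)
have Up := Kp _ (leq_maxl K L).
have [J Jq] := weakly_open_near oU Up (bdd _) (weakly_cvg_q (k := maxn K L)).
exists (q (maxn K L) J); split.
  by apply: UA; exact: Jq.
exact/LV/leq_maxr.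
Qed.

End WeakBook.

(** * The simplicial structure *)

Section BookComplex.
Variable R : realType.
Implicit Types (u v : 'rV[R]_2) (k j : nat) (s : nat * nat * bool).

Definition plane_point (a b : R) : 'rV[R]_2 := \row_i if i == 0 then a else b.

Lemma plane_pointE a b :
  (plane_point a b 0 0 = a) * (plane_point a b 0 1 = b).
Proof. by rewrite !mxE. Qed.

Lemma eq_plane_point u v : u 0 0 = v 0 0 -> u 0 1 = v 0 1 -> u = v.
Proof.
move=> uv0 uv1; apply/rowP => -[[|[|//]] i2].
  by rewrite (_ : Ordinal i2 = 0)//; apply: val_inj.
by rewrite (_ : Ordinal i2 = 1)//; apply: val_inj.
Qed.

(* [true] is the upper triangle [y, p, q], [false] the lower triangle
   [y, p, z]. *)
Definition triangle (upper : bool) (i : 'I_3) : 'rV[R]_2 :=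
  match val i with
  | 0 => plane_point 0 0
  | 1 => plane_point 1 1
  | _ => if upper then plane_point 0 2 else plane_point 1 0
  end.

(** The total weight [c] is 1 for points of the triangle and 0 for affine independence. *)
Definition barycentric (upper : bool) (c : R) v (i : nat) : R :=
  let a := v 0 0 in let b := v 0 1 in
  match i with
  | 0 => if upper then c - (a + b) / 2 else c - a
  | 1 => if upper then a else b
  | _ => if upper then (b - a) / 2 else a - b
  end.

Let o0 := @Ordinal 3 0 isT.
Let o1 := @Ordinal 3 1 isT.
Let o2 := @Ordinal 3 2 isT.

Lemma forall_ord3 (P : nat -> Prop) :
  (forall i : 'I_3, P i) <-> [/\ P 0%N, P 1%N & P 2%N].
Proof.
split=> [P3|[P0 P1 P2] [[|[|[|//]]] //]].
by split; [exact: (P3 o0)|exact: (P3 o1)|exact: (P3 o2)].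
Qed.

Lemma sum_ord3 (V : nmodType) (F : 'I_3 -> V) :
  \sum_i F i = F o0 + F o1 + F o2.
Proof.
rewrite !big_ord_recl big_ord0 addr0 addrA.
by congr (F _ + F _ + F _); exact: val_inj.
Qed.

Lemma sum_triangle upper (w : 'I_3 -> R) c v :
  (\sum_i w i = c /\ v = \sum_i w i *: triangle upper i) <->
  (forall i, w i = barycentric upper c v i).
Proof.
rewrite !sum_ord3 /triangle /=; split.
  move=> [<- ->] [[|[|[|//]]] i3]; rewrite (bool_irrelevance i3 isT);
    by case: upper; rewrite /barycentric /= !mxE /=; field.
move=> wE; rewrite !wE /barycentric /=; split; first by case: (upper); field.
by apply: eq_plane_point; case: (upper); rewrite !mxE /=; field.
Qed.

Lemma triangle_indep upper : affinely_independent (triangle upper).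
Proof.
move=> w w0 wv0 i.
have /sum_triangle -> : \sum_i w i = 0 /\ 0 = \sum_i w i *: triangle upper i by [].
by rewrite /barycentric !mxE; case: (val i) => [|[|_]]; case: (upper); ring.
Qed.

Definition face_condition (Q : pred nat) (x : R) (i : nat) : Prop :=
  0 <= x /\ (~~ Q i -> x = 0).

Lemma face_triangle upper (Q : pred nat) v :
  face (triangle upper) [set i : 'I_3 | Q i] v <->
  [/\ face_condition Q (barycentric upper 1 v 0) 0,
      face_condition Q (barycentric upper 1 v 1) 1 &
      face_condition Q (barycentric upper 1 v 2) 2].
Proof.
rewrite -(forall_ord3 (fun i => face_condition Q (barycentric upper 1 v i) i)).
split=> [[w [w0 wQ w1 vw]] i|vQ].
  have /sum_triangle wE : \sum_i w i = 1 /\ v = \sum_i w i *: triangle upper i by [].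
  rewrite -wE; split=> // Qi; by apply: wQ; rewrite inE.
have [w1 vw] : \sum_(i < 3) barycentric upper 1 v i = 1 /\
    v = \sum_(i < 3) barycentric upper 1 v i *: triangle upper i.
  exact/sum_triangle.
exists (fun i => barycentric upper 1 v i); split=> // i.
  by have [] := vQ i.
by rewrite inE; have [] := vQ i.
Qed.

Lemma simplexE upper : simplex (triangle upper) =
  face (triangle upper) [set i : 'I_3 | predT (i : nat)].
Proof. by congr face; apply/setP => i; rewrite !inE. Qed.

Definition coordinates s v : nat * nat * (R * R) := (s.1.1, s.1.2, (v 0 0, v 0 1)).

Definition half (upper : bool) (v : nat * nat * (R * R)) :=
  if upper then v.2.1 <= v.2.2 else v.2.2 <= v.2.1.

Lemma simplex_triangle s v : simplex (triangle s.2) v <->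
  trapezoid (coordinates s v) /\ half s.2 (coordinates s v).
Proof.
rewrite simplexE face_triangle /face_condition /half /barycentric /=.
split=> [[[h0 _] [h1 _] [h2 _]]|[/and4P[/= ? ? ? ?] h]].
  by case: s.2 h0 h1 h2 => h0 h1 h2; (split; [apply/and4P; split => /=|]); lra.
by case: s.2 h => h; split; split=> //; lra.
Qed.

(** The lower triangle of a page is listed once for every [j]; all copies have the same image. *)
Definition cell_to_book s v : book R := book_point (coordinates s v).

Lemma cell_to_book_eq s t u v :
  simplex (triangle s.2) u -> simplex (triangle t.2) v ->
  cell_to_book s u = cell_to_book t v <->
  normal_form (coordinates s u) = normal_form (coordinates t v).
Proof.
move=> /simplex_triangle[Qu _] /simplex_triangle[Qv _].
by rewrite -!val_book_point//; split=> [|/val_inj//]; rewrite /cell_to_book => ->.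
Qed.

Lemma normal_form_eq k j k' j' (a b a' b' : R) :
  normal_form (k, j, (a, b)) = normal_form (k', j', (a', b')) <->
  [/\ a = a', b = b', b = 0 \/ k = k' & b <= a \/ j = j'].
Proof.
rewrite /normal_form /=; split=> [[]|[-> -> kk jj]].
  move=> + + ab bb; rewrite -{}ab -{}bb.
  by case: eqVneq => [b0|_] kk; case: leP => [ba|_] jj; split; auto.
by case: kk => [/eqP ->|->]; case: jj => [->|->].
Qed.

Lemma cell_to_book_inj s u v :
  simplex (triangle s.2) u -> simplex (triangle s.2) v ->
  cell_to_book s u = cell_to_book s v -> u = v.
Proof.
by move=> us vs /(cell_to_book_eq us vs)/normal_form_eq[] *; exact: eq_plane_point.
Qed.

Lemma cell_to_book_cover (x : book R) :
  exists s, exists2 u, simplex (triangle s.2) u & cell_to_book s u = x.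
Proof.
have := book_trapezoid x; rewrite -{2}(book_pointK x).
case: (val x) => [[k j] [a b]] Qx.
exists (k, j, a <= b), (plane_point a b); last first.
  by rewrite /cell_to_book /coordinates !plane_pointE.
apply/simplex_triangle; rewrite /coordinates !plane_pointE; split=> //.
by rewrite /half /=; have [//|/ltW] := leP a b.
Qed.

(* Vertices [0] and [1] of every cell are [y] and [p]. *)
Definition common_face s t : pred nat := fun i =>
  if s.1.1 != t.1.1 then (i == 0%N) || ~~ s.2 && ~~ t.2 && (i == 2%N) else
  (i != 2%N) || (s.2 == t.2) && (s.2 ==> (s.1.2 == t.1.2)).

Lemma common_face_sym s t : common_face s t = common_face t s.
Proof.
apply/funext => i; rewrite /common_face eq_sym [s.2 == _]eq_sym [s.1.2 == _]eq_sym.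
by case: s t => [[k j] []] [[k' j'] []].
Qed.

Lemma face_common_face s t v :
  simplex (triangle s.2) v -> simplex (triangle t.2) v ->
  face (triangle s.2) [set i : 'I_3 | common_face s t i] v <->
  (v 0 1 = 0 \/ s.1.1 = t.1.1) /\ (v 0 1 <= v 0 0 \/ s.1.2 = t.1.2).
Proof.
rewrite !simplexE !face_triangle /face_condition /common_face /barycentric /=.
case: s t => [[k j] s] [[k' j'] t] /= [[s0 _] [s1 _] [s2 _]] [[t0 _] [t1 _] [t2 _]].
have [<-|kk] /= := eqVneq k k'; last first.
  split=> [[[_ c0] [_ c1] [_ c2]]|[[v0|/eqP]]]; last by rewrite (negbTE kk).
    case: s t s0 s1 s2 t0 t1 t2 c0 c1 c2 => [] [] /= s0 s1 s2 t0 t1 t2 c0 c1 c2;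
    have {}c1 := c1 isT; try (have {}c2 := c2 isT); split; left; lra.
  by move=> _; case: s t s0 s1 s2 t0 t1 t2 => [] [] /= *;
    split; split=> // _; lra.
have [<-|jj] /= := eqVneq j j'.
  split=> *; first by split; right.
  by case: s t s0 s1 s2 t0 t1 t2 => [] [] /= *; split; split=> // _; lra.
split=> [[[_ c0] [_ c1] [_ c2]]|[_ [ba|/eqP]]]; last by rewrite (negbTE jj).
  case: s t s0 s1 s2 t0 t1 t2 c0 c1 c2 => [] [] /= s0 s1 s2 t0 t1 t2 c0 c1 c2;
  try (have {}c2 := c2 isT); (split; [by right|left; lra]).
by case: s t s0 s1 s2 t0 t1 t2 => [] [] /= *; split; split=> // _; lra.
Qed.

Lemma sub_simplex_common_face s t :
  face (triangle s.2) [set i : 'I_3 | common_face s t i] `<=` simplex (triangle t.2).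
Proof.
move=> v; rewrite !simplexE !face_triangle /face_condition /common_face /barycentric /=.
case: s t => [[k j] s] [[k' j'] t] /= [[s0 c0] [s1 c1] [s2 c2]].
move: c0 c1 c2; have [_|_] /= := eqVneq k k'; case: s t s0 s1 s2 => [] [] /= s0 s1 s2 c0 c1 c2;
  try (have {}c1 := c1 isT); try (have {}c2 := c2 isT); by split; split=> //; lra.
Qed.

(** All cells sit in one plane in their unfolded position, so the gluing isometry can be the
    identity. *)
Lemma eq_common_face s t :
  face (triangle s.2) [set i : 'I_3 | common_face s t i] =
  face (triangle t.2) [set i : 'I_3 | common_face s t i].
Proof.
suff sub s' t' : face (triangle s'.2) [set i : 'I_3 | common_face s' t' i] `<=`
    face (triangle t'.2) [set i : 'I_3 | common_face s' t' i].
  by rewrite eqEsubset; split; [exact: sub|rewrite common_face_sym; exact: sub].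
move=> v Fv; have tv := sub_simplex_common_face Fv.
have sv : simplex (triangle s'.2) v.
  by case: Fv => w [w0 _ w1 vw]; exists w; split=> // i; rewrite inE.
move: Fv => /(face_common_face sv tv)[k j].
rewrite common_face_sym; apply/(face_common_face tv sv).
by split; [case: k|case: j] => ?; auto.
Qed.

Lemma cell_to_book_glue s t u v :
  simplex (triangle s.2) u -> simplex (triangle t.2) v ->
  cell_to_book s u = cell_to_book t v <->
  [/\ face (triangle s.2) [set i : 'I_3 | common_face s t i] u,
      face (triangle t.2) [set i : 'I_3 | common_face s t i] v & u = v].
Proof.
move=> us vt; rewrite cell_to_book_eq// normal_form_eq.
split=> [[aa bb kj jj]|[Fu _ uv]]; last first.
  by subst v; have [? ?] := (face_common_face us vt).1 Fu.
have uv : u = v by exact: eq_plane_point.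
by subst v; rewrite -eq_common_face; split=> //; apply/(face_common_face us vt).
Qed.

Lemma mdist_cell_to_book s u v :
  simplex (triangle s.2) u -> simplex (triangle s.2) v ->
  mdist (cell_to_book s u) (cell_to_book s v) = eucl_dist u v.
Proof.
move=> /simplex_triangle[Qu _] /simplex_triangle[Qv _].
apply: (pexpIrn (n := 2)) => //; rewrite ?nnegrE ?mdist_ge0 ?eucl_dist_ge0//.
rewrite mdist_book_point// val_book_point// sqdist_sym sqdist_normal_form//.
rewrite eucl_distE /sqdist /crease /= !eqxx /= !big_ord_recl big_ord0.
by rewrite (_ : lift ord0 ord0 = 1)//; [ring|exact: val_inj].
Qed.

(** * Strings realising the distance *)

Local Notation cell_string := (string_length (fun s => triangle s.2) cell_to_book).

Lemma string_length_cat (x y z : book R) L M :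
  cell_string x y L -> cell_string y z M -> cell_string x z (L + M).
Proof.
move=> xy; elim: xy z M => [{}x z M|s u v {}y {}L us vs vy IH z M yz].
  by rewrite add0r.
by rewrite -addrA; apply: string_cons => //; exact: IH.
Qed.

Lemma mdist_le_string (x y : book R) L : cell_string x y L -> mdist x y <= L.
Proof.
elim=> [{}x|s u v {}y {}L us vs _ IH]; first by rewrite mdistxx.
apply: le_trans (metric_triangle _ (cell_to_book s v) _) _.
by rewrite (mdist_cell_to_book us vs) lerD2l.
Qed.

Definition strung (x y : book R) := cell_string x y (mdist x y).

Lemma strung_stewart t (x m y : book R) : 0 <= t <= 1 -> stewart t x y m ->
  strung x m -> strung m y -> strung x y.
Proof.
move=> t01 xym xm my; have [xmE myE] := stewart_dist t01 xym.
rewrite /strung.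
have -> : mdist x y = mdist x m + mdist m y by rewrite xmE myE; ring.
exact: string_length_cat xm my.
Qed.

Lemma strung_cell upper k j (a b a' b' : R) :
  trapezoid (k, j, (a, b)) -> half upper (k, j, (a, b)) ->
  trapezoid (k, j, (a', b')) -> half upper (k, j, (a', b')) ->
  strung (book_point (k, j, (a, b))) (book_point (k, j, (a', b'))).
Proof.
move=> Qx hx Qy hy; pose s := (k, j, upper).
pose u := plane_point a b; pose v := plane_point a' b'.
have us : simplex (triangle s.2) u.
  by apply/simplex_triangle; rewrite /coordinates !plane_pointE.
have vs : simplex (triangle s.2) v.
  by apply/simplex_triangle; rewrite /coordinates !plane_pointE.
have : cell_string (cell_to_book s u) (cell_to_book s v) (eucl_dist u v).
  by rewrite -[eucl_dist u v]addr0; apply: string_cons => //; exact: string_nil.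
by rewrite -(mdist_cell_to_book us vs) /cell_to_book /coordinates !plane_pointE.
Qed.

Lemma strung_leaf k j (a b a' b' : R) :
  trapezoid (k, j, (a, b)) -> trapezoid (k, j, (a', b')) ->
  strung (book_point (k, j, (a, b))) (book_point (k, j, (a', b'))).
Proof.
move=> Qx Qy.
have cross upper upper' t : 0 <= t <= 1 ->
    half upper (k, j, (a, b)) -> half upper' (k, j, (a', b')) ->
    (1 - t) * a + t * a' = (1 - t) * b + t * b' ->
    strung (book_point (k, j, (a, b))) (book_point (k, j, (a', b'))).
  move=> t01 hx hy mE.
  pose m := (k, j, ((1 - t) * a + t * a', (1 - t) * b + t * b')).
  have Qm : trapezoid m by exact: trapezoid_convex Qx Qy.
  have hm up : half up m by rewrite /half /= mE lexx if_same.
  apply: (@strung_stewart t _ (book_point m)) => //.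
  - exact/stewart_book_point/stewart_raw_leaf.
  - exact: (@strung_cell upper).
  - exact: (@strung_cell upper').
have [ba|ab] := leP b a; have [ba'|ab'] := leP b' a'.
- exact: (@strung_cell false).
- have t0 : 0 < (b' - a') + (a - b) by lra.
  (* The ratio at which the segment crosses the diagonal. *)
  apply: (cross false true ((a - b) / ((b' - a') + (a - b)))) => //.
  + by rewrite divr_ge0 ?ler_pdivrMr ?mul1r//; lra.
  + exact: ltW.
  + by field; lra.
- have t0 : 0 < (b - a) + (a' - b') by lra.
  apply: (cross true false ((b - a) / ((b - a) + (a' - b')))) => //.
  + by rewrite divr_ge0 ?ler_pdivrMr ?mul1r//; lra.
  + exact: ltW.
  + by field; lra.
- by apply: (@strung_cell true) => //; exact: ltW.
Qed.

Lemma eq_book_point k j k' j' (a b : R) :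
  b = 0 \/ k = k' -> b <= a \/ j = j' ->
  book_point (k, j, (a, b)) = book_point (k', j', (a, b)).
Proof.
by move=> kk jj; rewrite /book_point (_ : normal_form _ = normal_form (k', j', (a, b)))//;
  apply/normal_form_eq.
Qed.

Lemma strung_all (x y : book R) : strung x y.
Proof.
rewrite -(book_pointK x) -(book_pointK y).
move: (book_trapezoid x) (book_normal_form x) (book_trapezoid y) (book_normal_form y).
case: (val x) (val y) => [[k j] [a b]] [[k' j'] [a' b']] Qx nx Qy ny.
have /and4P[/= a0 a1 b0 ab] := Qx; have /and4P[/= a0' a1' b0' ab'] := Qy.
have [kk|kk] := eqVneq k k'; last first.
  (* Two points on the edge would both have page 0 in normal form. *)
  have {nx ny} bb : 0 < b + b'.
    rewrite lt_neqAle addr_ge0// andbT eq_sym paddr_eq0//.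
    apply: contra kk => /andP[/eqP bE /eqP bE']; move: nx ny.
    by rewrite /normal_form /= bE bE' eqxx => -[<- _] -[<- _].
  (* With this ratio the dividing point falls on the edge, hence on both pages, and each half stays
     in one leaf. *)
  pose t := b / (b + b'); have t01 : 0 <= t <= 1.
    by rewrite divr_ge0 ?ler_pdivrMr ?mul1r//; lra.
  have mE : (1 - t) * b - t * b' = 0 by rewrite /t; field; lra.
  have := @stewart_raw_page R t k j k' j' a b a' b' t01 kk Qx Qy.
  rewrite mE lexx => /(_ isT).
  set c := (1 - t) * a + t * a' => xym.
  have Qm l i : trapezoid (l, i, (c, 0)).
    by move: t01 => /andP[? ?]; apply/and4P; rewrite /c; split => //=; nra.
  apply: (strung_stewart t01 (stewart_book_point Qx Qy (Qm _ _) xym)).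
    exact: strung_leaf.
  rewrite (@eq_book_point k j k' j'); [exact: strung_leaf|by left|left].
  by have /and4P[] := Qm 0%N 0%N.
subst k'; clear nx ny.
have [jj|jj] := eqVneq j j'; first by subst j'; exact: strung_leaf.
have [ba|ba] := leP b a.
  by rewrite (@eq_book_point k j k j'); [exact: strung_leaf|right|left].
have [ba'|ba'] := leP b' a'.
  by rewrite (@eq_book_point k j' k j); [exact: strung_leaf|right|left].
have bb : 0 < (b - a) + (b' - a') by lra.
(* Likewise, the dividing point falls on the diagonal and belongs to both sheets. *)
pose t := (b - a) / ((b - a) + (b' - a')); have t01 : 0 <= t <= 1.
  by rewrite divr_ge0 ?ler_pdivrMr ?mul1r//; lra.
have mE : (1 - t) * b + t * a' = (1 - t) * a + t * b' by rewrite /t; field; lra.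
have := @stewart_raw_flap R t k j j' a b a' b' t01 jj (ltW ba) (ltW ba').
rewrite mE lexx => /(_ isT).
set c := (1 - t) * a + t * b' => xym.
have Qm l i : trapezoid (l, i, (c, c)).
  by move: t01 => /andP[? ?]; apply/and4P; split => //=; rewrite -1?mE /c; nra.
apply: (strung_stewart t01 (stewart_book_point Qx Qy (Qm _ _) xym)).
  exact: strung_leaf.
rewrite (@eq_book_point k j k j'); [exact: strung_leaf|by right|by left].
Qed.

Lemma book_string (x y : book R) : [set L | cell_string x y L] !=set0.
Proof. by exists (mdist x y); exact: strung_all. Qed.

Lemma book_mdist_inf (x y : book R) : mdist x y = inf [set L | cell_string x y L].
Proof.
apply/eqP; rewrite eq_le; apply/andP; split.
  by apply: lb_le_inf (book_string x y) _ => L; exact: mdist_le_string.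
apply: ge_inf (strung_all x y); exists 0 => L /mdist_le_string.
exact: le_trans (mdist_ge0 _ _).
Qed.

Lemma book_glue s t :
  (exists u v, [/\ simplex (triangle s.2) u, simplex (triangle t.2) v &
    cell_to_book s u = cell_to_book t v]) ->
  exists F G h,
    isometry_onto (face (triangle s.2) F) (face (triangle t.2) G) h /\
    forall u v, simplex (triangle s.2) u -> simplex (triangle t.2) v ->
      (cell_to_book s u = cell_to_book t v <->
       [/\ face (triangle s.2) F u, face (triangle t.2) G v & h u = v]).
Proof.
move=> _; pose F := [set i : 'I_3 | common_face s t i]%SET.
exists F, F, id; split; last by move=> u v; exact: cell_to_book_glue.
by split=> //; rewrite image_id; exact: eq_common_face.
Qed.

Definition book_complex : euclidean_simplicial_complex (book R) :=
  @Build_euclidean_simplicial_complex R (book R) (nat * nat * bool)%type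
    (fun=> 2%N) (fun s => triangle s.2) cell_to_book
    (fun s => @triangle_indep s.2) cell_to_book_inj cell_to_book_cover
    book_glue book_string book_mdist_inf.

End BookComplex.

Theorem proposition1p3 (R : realType) :
  exists (X : metricType R) (K : euclidean_simplicial_complex X),
    [/\ cat0 X, mbounded (@setT X), mseparable X, two_dimensional K &
        ~ hausdorff_space (weak_space X)].
Proof.
exists (book R), (book_complex R); split.
- split; first exact: book_complete.
    exact: stewart_geodesic_space (@book_stewart_ex R).
  exact: stewart_cat0_inequality (@book_stewart_ex R).
- exact: book_bounded.
- exact: book_separable.
- by split=> //; exists (0%N, 0%N, true).
- exact: book_weak_not_hausdorff.
Qed.
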